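(* Let $f:\mathbb{R}^n\to\mathbb{R}$ be a continuous convex function and let $g:\mathbb{R}^n\to\mathcal{Y}$ be a continuous mapping such that $G_K(x)=-g(x)+K$ is a graph-convex set-valued mapping. Assume that for every $h_x\in\mathbb{R}^n$ $$f^{\infty}(h_x)\le 0\ \text{ and }\ 0\in G_K^{\infty}(h_x)\ \Longrightarrow\ h_x=0.$$ Then: (a) The function $\nu$ is proper, lower semi-continuous and convex on $\mathcal{Y}$, and for each $s\in\mathrm{dom}\,\nu$ the set $X(s)$ is nonempty, compact and convex, whereas $X(s)=\emptyset$ when $s\notin\mathrm{dom}\,\nu$. (b) The mapping $X$, which is compact-valued with $\mathrm{dom}\,X=\mathrm{dom}\,\nu$, is outer semi-continuous with respect to $\nu$-attentive convergence. (c) The set-valued mapping $X$ is locally bounded and outer semi-continuous relative to the set $\mathrm{int}(\mathrm{dom}\,X)=\mathrm{int}(\mathrm{dom}\,\nu)$.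
   Context: $\mathcal{Y}$ is a finite dimensional Hilbert space and $K\subset\mathcal{Y}$ is a nonempty closed convex set. $G_K:\mathbb{R}^n\rightrightarrows\mathcal{Y}$, $G_K(x):=-g(x)+K$, is graph-convex if $\mathrm{gph}\,G_K=\{(x,s): g(x)+s\in K\}$ is convex in $\mathbb{R}^n\times\mathcal{Y}$. $G_K^{\infty}$ is the set-valued mapping whose graph is the horizon (recession) cone of $\mathrm{gph}\,G_K$. $f^\infty$ is the horizon (recession) function of $f$, i.e. $f^\infty(h)=\lim_{t\to\infty}\frac{f(x+th)-f(x)}{t}$ for any $x$. For $s\in\mathcal{Y}$, $\Phi(s)=\{x\in\mathbb{R}^n: g(x)+s\in K\}$, $\nu(s)=\inf\{f(x): x\in\Phi(s)\}$ (with $\inf\emptyset=+\infty$) and $X(s)=\mathrm{argmin}\{f(x): x\in\Phi(s)\}$ (so $X(s)=\emptyset$ if $\Phi(s)=\emptyset$). $\mathrm{dom}\,\nu=\{s:\nu(s)<+\infty\}$ and $\mathrm{dom}\,X=\{s: X(s)\neq\emptyset\}$. Outer semi-continuity with respect to $\nu$-attentive convergence means: whenever $s^k\to\hat s$ with $\nu(s^k)\to\nu(\hat s)$, $x^k\in X(s^k)$ and $x^k\to x$, one has $x\in X(\hat s)$. Outer semi-continuity relative to a set $U$ is the same with the sequences $s^k\in U$, $s^k\to\hat s\in U$ (without requiring $\nu(s^k)\to\nu(\hat s)$). $X$ is locally bounded relative to $U$ if each point $\hat s\in U$ has a neighborhood $V$ such that $\bigcup_{s\in V\cap U}X(s)$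 is bounded. *)

(* Defs.v *)
From HB Require Import structures.
From mathcomp Require Import all_boot all_order all_algebra.
From mathcomp Require Import sesquilinear.
From mathcomp Require Import all_classical all_reals all_analysis.
From mathcomp Require Import ring lra.
Set Implicit Arguments.
Unset Strict Implicit.
Unset Printing Implicit Defensive.
Import Order.TTheory GRing.Theory Num.Theory.
Import numFieldNormedType.Exports.
Local Open Scope classical_set_scope.
Local Open Scope ring_scope.

(* R^n is 'rV[R]_n with the library's sup norm: only its topology and its
   bounded sets matter below, so the choice of norm is irrelevant. *)

Definition finite_dimensional (R : realType) (V : lmodType R) : Prop :=
  exists (d : nat) (b : 'I_d -> V),
    forall v : V, exists c : 'I_d -> R, v = \sum_(i < d) c i *: b i.

(* The norm of V (hence its topology) is the one of the inner product dotp;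
   together with completeness this makes V a Hilbert space. *)
Definition norm_of_dot (R : realType) (V : normedModType R)
    (dotp : {dot V for @idfun R}) : Prop :=
  forall v : V, `|v| ^+ 2 = dotp v v.

Section SetValuedMaps.
Context {R : realType} {E F : normedModType R}.
Implicit Types (G : E -> set F) (U : set E).

Definition graph G : set (E * F) := [set p | G p.1 p.2].

Definition graph_convex G : Prop := @convex_set R (E * F)%type (graph G).

Definition domain G : set E := [set x | G x !=set0].

Definition locally_bounded_rel G U : Prop :=
  forall x, U x ->
    exists2 V, nbhs x V & bounded_set (\bigcup_(z in V `&` U) G z).

Definition osc_rel G U : Prop :=
  forall (u : nat -> E) (a : E) (v : nat -> F) (b : F),
    (forall k, U (u k)) -> U a -> u @ \oo --> a ->
    (forall k, G (u k) (v k)) -> v @ \oo --> b -> G a b.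

Definition osc_attentive (nu : E -> \bar R) G : Prop :=
  forall (u : nat -> E) (a : E) (v : nat -> F) (b : F),
    u @ \oo --> a -> (nu \o u) @ \oo --> nu a ->
    (forall k, G (u k) (v k)) -> v @ \oo --> b -> G a b.

End SetValuedMaps.

(* Horizon cone: limits of lambda_k x_k with x_k in C and lambda_k > 0
   tending to 0, and {0} when C is empty. *)
Definition horizon_cone (R : realType) (V : normedModType R) (C : set V) :
    set V :=
  [set w | (C = set0 /\ w = 0) \/
    exists (x : nat -> V) (lambda : nat -> R),
      [/\ forall k, C (x k), forall k, 0 < lambda k,
          lambda @ \oo --> (0 : R) &
          (fun k => lambda k *: x k) @ \oo --> w]].

Definition horizon_map (R : realType) (E F : normedModType R)
    (G : E -> set F) : E -> set F :=
  fun h => [set w | horizon_cone (graph G) (h, w)].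

Definition horizon_quotient (R : realType) (V : normedModType R) (f : V -> R)
    (x h : V) (t : R) : \bar R :=
  ((f (x + t *: h) - f x) / t)%:E.

(* The base point is 0; by horizon_fun_cvg below any other base point gives
   the same function when f is convex and continuous. *)
Definition horizon_fun (R : realType) (V : normedModType R) (f : V -> R)
    (h : V) : \bar R :=
  lim (horizon_quotient f 0 h t @[t --> +oo]).

Section HorizonFun.
Context {R : realType} {V : normedModType R}.
Variable f : V -> R.
Hypothesis f_convex : @convex_function R V setT f.
Hypothesis f_cont : continuous f.

Let fJ (e : R) (a b : V) : 0 <= e <= 1 ->
  f (e *: a + (1 - e) *: b) <= e * f a + (1 - e) * f b.
Proof.
move=> /andP[e0 e1].
exact: (@f_convex (Itv01 e0 e1) a b (in_setT _) (in_setT _)).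
Qed.

Let quotient_mono x h (t u : R) : 0 < t -> t <= u ->
  (f (x + t *: h) - f x) / t <= (f (x + u *: h) - f x) / u.
Proof.
move=> t0 tu; have u0 : 0 < u by exact: lt_le_trans tu.
have e01 : 0 <= t / u <= 1 
    by apply/andP; split; [rewrite divr_ge0// ltW | rewrite ler_pdivrMr// mul1r].
have := @fJ (t / u) (x + u *: h) x e01.
rewrite scalerDr scalerA divfK ?gt_eqF// addrAC -scalerDl addrC.
rewrite [_ + (1 - _)]addrC subrK scale1r addrC => fle.
rewrite ler_pdivrMr// [leRHS]mulrAC -mulrA [leRHS]mulrC.
rewrite mulrBr; lra.
Qed.

Let slope x h : \bar R :=
  ereal_sup (range (fun t => horizon_quotient f x h (Num.max 1 t))).

Let quotient_cvg x h : horizon_quotient f x h t @[t --> +oo] --> slope x h.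
Proof.
have nd : nondecreasing_fun (fun t => horizon_quotient f x h (Num.max 1 t)).
  move=> t u tu; rewrite /horizon_quotient lee_fin; apply: quotient_mono.
    by rewrite lt_max ltr01.
  by rewrite ge_max !le_max lexx/= tu orbT.
have := nondecreasing_cvge nd; apply: cvg_trans; apply: near_eq_cvg.
near=> t; congr horizon_quotient; apply/max_idPr.
by near: t; exact: nbhs_pinfty_ge.
Unshelve. all: by end_near. Qed.

Let slope_le x y h : (slope x h <= slope y h)%E.
Proof.
apply: ge_ereal_sup => _ [t0 _ <-]; set t := Num.max 1 t0.
have t_gt0 : 0 < t by rewrite lt_max ltr01.
have ubY u : 0 < u -> (((f (y + u *: h) - f y) / u)%:E <= slope y h)%E.
  move=> u0; apply: (@le_trans _ _ (horizon_quotient f y h (Num.max 1 u))).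
    by rewrite lee_fin quotient_mono// le_max lexx orbT.
  by apply: ereal_sup_ubound; exists u.
case: (slope y h) ubY => [r| |] ubY; last 2 first.
- by rewrite leey.
- by have := ubY 1 ltr01.
rewrite lee_fin ler_pdivrMr// lerBlDl.
set k := fun e : R => f (x + t *: h + e *: (y - x)).
have kc : k e @[e --> 0^'+] --> f (x + t *: h).
  apply: cvg_at_right_filter.
  have -> : f (x + t *: h) = k 0 by rewrite /k scale0r addr0.
  apply: (@continuous_comp _ _ _ (fun e : R => x + t *: h + e *: (y - x)) f).
    by apply: cvgD; [exact: cvg_cst | apply: cvgZr_tmp; exact: cvg_id].
  exact: f_cont.
have rc : f x + r * t + e * (f y - f x) @[e --> (0 : R)^'+] --> f x + r * t.
  apply: cvg_at_right_filter; rewrite -[X in _ --> X]addr0.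
  apply: cvgD; first exact: cvg_cst.
  rewrite -[X in _ --> X](mul0r (f y - f x)); apply: cvgMr_tmp; exact: cvg_id.
apply: (ler_cvg_to kc rc); near=> e.
have e0 : 0 < e by near: e; exact: nbhs_right_gt.
have e1 : e <= 1 by near: e; apply: nbhs_right_le.
have u0 : 0 < t / e by rewrite divr_gt0.
have := ubY _ u0; rewrite lee_fin ler_pdivrMr// => fy.
have e01 : 0 <= e <= 1 by rewrite ltW.
have := @fJ e (y + (t / e) *: h) x e01.
have -> : e *: (y + (t / e) *: h) + (1 - e) *: x =
    x + t *: h + e *: (y - x).
  rewrite scalerDr scalerA mulrCA divff ?gt_eqF// mulr1 scalerBl scale1r.
  by rewrite scalerBr addrC -!addrA; congr (x + _); rewrite addrC -addrA addrCA.
rewrite -/(k e) => /le_trans; apply.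
have : e * (f (y + (t / e) *: h) - f y) <= r * t.
  rewrite -(@ler_pM2l _ e) // in fy; apply: (le_trans fy).
  by rewrite mulrCA [e * _]mulrCA divff ?gt_eqF// mulr1.
by rewrite mulrBr; lra.
Unshelve. all: by end_near. Qed.

Lemma horizon_fun_cvg x h :
  horizon_quotient f x h t @[t --> +oo] --> horizon_fun f h.
Proof.
have -> : horizon_fun f h = slope x h; last exact: quotient_cvg.
rewrite /horizon_fun (cvg_lim _ (@quotient_cvg 0 h))//.
by apply/eqP; rewrite eq_le !slope_le.
Qed.

End HorizonFun.

Section ExtendedRealFunctions.
Context {R : realType} {V : normedModType R}.
Implicit Types phi : V -> \bar R.
Local Open Scope ereal_scope.

Definition edom phi : set V := [set s | phi s < +oo].

Definition proper_fun phi : Prop :=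
  edom phi !=set0 /\ forall s, -oo < phi s.

(* Convexity of the epigraph, so that no convention for +oo - oo is needed. *)
Definition econvex phi : Prop :=
  @convex_set R (V * R^o)%type [set p | phi p.1 <= (p.2 : R)%:E].

End ExtendedRealFunctions.

Section ParametricProblem.
Context {R : realType} {E Y : normedModType R}.
Variables (f : E -> R) (g : E -> Y) (K : set Y).

Definition GK : E -> set Y := fun x => [set - g x + k | k in K].

Definition feasible (s : Y) : set E := [set x | K (g x + s)].

Definition value_fun (s : Y) : \bar R :=
  ereal_inf [set (f x)%:E | x in feasible s].

Definition solution_set (s : Y) : set E :=
  [set x | feasible s x /\ forall z, feasible s z -> f x <= f z].

End ParametricProblem.

Lemma graph_GK (R : realType) (E Y : normedModType R) (g : E -> Y)
    (K : set Y) :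
  graph (GK g K) = [set p | K (g p.1 + p.2)].
Proof.
apply/seteqP; split=> -[x s]; rewrite /graph /GK /=.
  by case=> k Kk <-; rewrite addrA subrr add0r.
by move=> Ks; exists (g x + s) => //; rewrite addrA addNr add0r.
Qed.

(* Main.v *)
Require Import Defs.
From HB Require Import structures.
From mathcomp Require Import all_boot all_order all_algebra.
From mathcomp Require Import sesquilinear.
From mathcomp Require Import all_classical all_reals all_analysis.
From mathcomp Require Import ring lra.
Set Implicit Arguments.
Unset Strict Implicit.
Unset Printing Implicit Defensive.
Import Order.TTheory GRing.Theory Num.Theory.
Import numFieldNormedType.Exports.
Local Open Scope classical_set_scope.
Local Open Scope ring_scope.

(** Everything rests on one compactness fact, [sublevel_bounded]: on a bounded
set of parameters [s], the feasible points [x] with [f x <= a] stay in a fixed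
ball.  Were this false, there would be feasible pairs [(x_k, s_k)] with [s_k]
bounded, [f x_k <= a] and [`|x_k|] tending to infinity.  Divide them by
[`|x_k|]: along a subsequence the first components tend to a unit vector [h]
and the second ones to [0], so that [(h, 0)] lies in the horizon cone of the
graph of [GK].  By convexity [f] does not increase in the direction [h], hence
its horizon function is nonpositive at [h], and the horizon condition gives
[h = 0], a contradiction.

Therefore the sublevel sets of [f] on each feasible set are compact, the
infimum defining the value function is attained as soon as a feasible point
exists, and [value_fun s <= a] says exactly that some feasible [x] has
[f x <= a] ([value_fun_leP]): the epigraph of the value function is a
projection of a convex set, and compactness makes it closed.  This yields (a).

For (b) and (c), a limit of solutions is feasible because the graph is closed,
and it is optimal as soon as the values along the sequence do not exceed the
limiting value asymptotically ([solution_set_limit]).  Attentive convergence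
provides this by definition.  In the interior of the domain it is the upper
semicontinuity of a lower semicontinuous convex function: by Baire's theorem
some sublevel set contains a ball, convexity carries the resulting upper bound
to a neighbourhood of any interior point of the domain
([interior_edom_locally_bounded]), and a convex function that is bounded above
near a point is upper semicontinuous there ([econvex_usc]).  The same local
upper bound, combined with [sublevel_bounded], shows that the solution mapping
is locally bounded. *)

(** * Convex combinations with real coefficients *)

Section ConvexCombinations.
Context {R : realType}.

Lemma convex_setP (V : lmodType R) (A : set V) :
  @convex_set R V A <->
  forall (t : R) x y, 0 <= t <= 1 -> A x -> A y -> A (t *: x + (1 - t) *: y).
Proof.
split=> [cA t x y /andP[t0 t1] Ax Ay|cA x y t /set_mem Ax /set_mem Ay].
  by have /set_mem := cA x y (Itv01 t0 t1) (mem_set Ax) (mem_set Ay).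
by apply/mem_set; apply: cA => //; rewrite ge0 le1.
Qed.

Lemma convex_functionT (V : lmodType R) (f : V -> R) (t : R) x y :
  @convex_function R V setT f -> 0 <= t <= 1 ->
  f (t *: x + (1 - t) *: y) <= t * f x + (1 - t) * f y.
Proof.
move=> cf /andP[t0 t1].
exact: (@cf (Itv01 t0 t1) x y (in_setT _) (in_setT _)).
Qed.

Lemma econvexP (V : normedModType R) (phi : V -> \bar R) :
  econvex phi <->
  forall (t a b : R) x y, 0 <= t <= 1 ->
    (phi x <= a%:E)%E -> (phi y <= b%:E)%E ->
    (phi (t *: x + (1 - t) *: y)%R <= (t * a + (1 - t) * b)%:E)%E.
Proof.
rewrite /econvex convex_setP; split=> [H t a b x y t01 xa yb|H t [x a] [y b]].
  exact: (H t (x, a) (y, b)).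
exact: H.
Qed.

End ConvexCombinations.

(** * Convergent subsequences *)

Lemma near_dist_lt (R : realType) (V : normedModType R) (a : V) (e : R) :
  0 < e -> \forall z \near a, `|a - z| < e.
Proof. by move=> e0; apply/nbhs_normP; exists e. Qed.

Section Subsequences.
Context {R : realType}.

Lemma cvg_infty_ge (phi : nat -> nat) :
  (forall k, (k <= phi k)%N) -> phi @ \oo --> \oo.
Proof.
move=> phik A [N _ NA]; exists N => // k /= Nk.
by apply: NA => /=; exact: leq_trans (phik k).
Qed.

(** The selected indices need not increase: that they tend to infinity is
enough for every limit taken along the original sequence to survive. *)
Lemma compact_subsequence (V : normedModType R) (A : set V) (u : nat -> V) :
  compact A -> (forall k, A (u k)) ->
  exists a (phi : nat -> nat),
    [/\ A a, phi @ \oo --> \oo & (u \o phi) @ \oo --> a].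
Proof.
move=> cA Au.
have FA : (u @ \oo) A by exists 0%N => // k _; exact: Au.
have [a [Aa cla]] := cA (u @ \oo) _ FA.
have ex (k : nat) : exists j, (k <= j)%N /\ `|a - u j| < k.+1%:R^-1.
  have tk : (u @ \oo) (u @` [set j | (k <= j)%N]) by exists k => // j /= kj; exists j.
  have bk : nbhs a (ball a k.+1%:R^-1 : set V).
    by apply: nbhsx_ballx; rewrite invr_gt0 ltr0n.
  have [_ [[j /= kj <-]]] := cla _ _ tk bk.
  by rewrite -ball_normE => ?; exists j.
have [phi phiP] := choice ex.
exists a, phi; split => //; first by apply: cvg_infty_ge => k; case: (phiP k).
apply/cvgrPdist_lt => e e0; near=> k.
apply: (lt_trans (phiP k).2).
by near: k; exact: near_infty_natSinv_lt (PosNum e0).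
Unshelve. all: by end_near. Qed.

End Subsequences.

(** * Lower semicontinuous convex functions inside their domain *)

Section ConvexInterior.
Context {R : realType} {V : completeNormedModType R}.
Variable phi : V -> \bar R.
Hypotheses (phi_lsc : lower_semicontinuous phi) (phi_cvx : econvex phi).

(** The sublevel sets at integer levels are closed and cover the domain, which
has nonempty interior, so by Baire's theorem one of them contains a ball.  As
[a] lies strictly between the centre of that ball and some other point of the
domain, the points near [a] are convex combinations, with fixed weights, of
that other point and points of the ball. *)
Lemma interior_edom_locally_bounded a : (edom phi)^° a ->
  exists M : R, \forall y \near a, (phi y <= M%:E)%E.
Proof.
move=> a_int.
pose O (m : nat) := [set s : V | (m%:R%:E < phi s)%E].
have O_open m : open (O m) by exact: (lower_semicontinuousP phi).1.
have [m [s0 [r r0 Br]]] :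
    exists m s0, exists2 r : R, 0 < r & ball s0 r `<=` ~` O m.
  have [m /denseNE[U [[s0 [oU Us0]] UO]]] : exists m, ~ dense (O m).
    apply/not_existsP => dO.
    have dI : dense (\bigcap_m O m).
      by apply: Baire => m; split => //; have /contrapT := dO m.
    have := dI (edom phi)^°.
    case; [by exists a | exact: open_interior |] => s [/interior_subset].
    rewrite /edom /= => slt sO.
    have [M sM] : exists M : R, (phi s <= M%:E)%E.
      case: (phi s) slt => [M| |] // _; [by exists M | by exists 0; rewrite leNye].
    have := sO (Num.truncn `|M|).+1 Logic.I; rewrite /O /= ltNge => /negP; apply.
    apply: (le_trans sM); rewrite lee_fin (le_trans (ler_norm _))// ltW//.
    exact: truncnS_gt.
  have /nbhs_ballP[r r0 Ur] : nbhs s0 U by exact: open_nbhs_nbhs.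
  exists m, s0, r => // s /Ur Us Os.
  by have : (U `&` O m) s by []; rewrite UO.
(* Prolong the segment from s0 to a slightly beyond a, within the domain; the
   weight t below is the one for which t *: y + (1 - t) *: s0 is a. *)
have [d d0 yd] : exists2 d : R, 0 < d & edom phi (a + d *: (a - s0)).
  have : \forall d \near (0 : R)^'+, edom phi (a + d *: (a - s0)).
    have : (fun d : R => a + d *: (a - s0)) d @[d --> (0 : R)^'+] --> a.
      apply: cvg_at_right_filter; rewrite -[X in _ --> X]addr0.
      apply: cvgD; first exact: cvg_cst.
      rewrite -[X in _ --> X](scale0r (a - s0)); apply: cvgZr_tmp; exact: cvg_id.
    by move=> cv; exact: (cv _ a_int).
  move=> dn; near (0 : R)^'+ => d; exists d; first by near: d; exact: nbhs_right_gt.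
  by near: d.
set y := a + d *: (a - s0) in yd.
have [M yM] : exists M : R, (phi y <= M%:E)%E.
  by move: yd; rewrite /edom /=; case: (phi y) => [M| |] // _;
    [exists M | exists 0; rewrite leNye].
have d1 : 0 < 1 + d by rewrite addr_gt0.
pose t := (1 + d)^-1.
have t0 : 0 < t by rewrite invr_gt0.
have t1 : t < 1 by rewrite invf_lt1// ltrDl.
have onemt : 1 - t = d * t by rewrite /t; field; rewrite gt_eqF.
have dt0 : 0 < d * t by rewrite mulr_gt0.
exists (t * M + (1 - t) * m%:R); near=> z.
(* w is the point of the ball for which z = t *: y + (1 - t) *: w. *)
pose w := s0 + (d * t)^-1 *: (z - a).
have -> : z = t *: y + (1 - t) *: w.
  rewrite onemt /w /y !scalerDr !scalerA mulfV ?gt_eqF// scale1r.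
  rewrite scalerN (mulrC t d) !scalerN addrA.
  rewrite -(addrA (t *: a)) subrK -scalerDl -{1}(mul1r t) -mulrDl /t.
  by rewrite divff ?gt_eqF// scale1r addrCA subrr addr0.
apply: ((econvexP phi).1 phi_cvx) => //; first by rewrite !ltW.
have : ball s0 r w.
  rewrite -ball_normE /= /w opprD addNKr normrN normrZ gtr0_norm ?invr_gt0//.
  rewrite mulrC ltr_pdivrMr// distrC.
  by near: z; apply: near_dist_lt; rewrite mulr_gt0.
by move=> /Br; rewrite /O /= => /negP; rewrite -leNgt.
Unshelve. all: by end_near. Qed.

(** If [phi <= M] on the ball of radius [r] around [a], then a point [y] at
distance less than [t * r] from [a] is a convex combination of [a] and a point
of that ball with weight [t] on the latter, so that
[phi y <= t * M + (1 - t) * c], which is at most [c + e] once [t] is small. *)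
Lemma econvex_usc a (c e : R) : (edom phi)^° a -> (phi a <= c%:E)%E -> 0 < e ->
  \forall y \near a, (phi y <= (c + e)%:E)%E.
Proof.
move=> /interior_edom_locally_bounded[M /nbhs_ballP[r /= r0 Mr]] ac e0.
have Mc0 : 0 < `|M - c| + e by rewrite ltr_wpDl.
pose t := e / (`|M - c| + e).
have t0 : 0 < t by rewrite divr_gt0.
have t1 : t <= 1 by rewrite ler_pdivrMr// mul1r lerDr.
have tM : t * M + (1 - t) * c <= c + e.
  have : t * (M - c) <= t * (`|M - c| + e).
    by rewrite ler_pM2l// (le_trans (ler_norm _))// lerDl ltW.
  by rewrite {2}/t divfK ?gt_eqF// ; lra.
near=> y.
have -> : y = t *: (a + t^-1 *: (y - a)) + (1 - t) *: a.
  rewrite scalerDr scalerA divff ?gt_eqF// scale1r addrAC -scalerDl.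
  by rewrite addrC [t + _]addrC subrK scale1r subrK.
apply: (@le_trans _ _ (t * M + (1 - t) * c)%:E); last by rewrite lee_fin.
apply: ((econvexP phi).1 phi_cvx) => //; first by rewrite ltW.
apply: Mr; rewrite -ball_normE /= opprD addNKr normrN normrZ gtr0_norm ?invr_gt0//.
rewrite mulrC ltr_pdivrMr// distrC.
by near: y; apply: near_dist_lt; rewrite mulr_gt0.
Unshelve. all: by end_near. Qed.

End ConvexInterior.

(** * Horizon directions of a sublevel set *)

Section HorizonDirections.
Context {R : realType} {V : normedModType R}.
Variable f : V -> R.
Hypotheses (f_cont : continuous f)
           (f_convex : @convex_function R V setT f).

(** Convexity between [0] and [x k], with weight [t * lambda k] on [x k],
gives in the limit [f (t *: h) <= f 0] for every [t > 0]; so all difference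
quotients of [f] at [0] in the direction [h] are nonpositive. *)
Lemma horizon_fun_le0 (a : R) (x : nat -> V) (lambda : nat -> R) h :
  (forall k, f (x k) <= a) -> (forall k, 0 < lambda k) ->
  lambda @ \oo --> (0 : R) -> (fun k => lambda k *: x k) @ \oo --> h ->
  (horizon_fun f h <= 0)%E.
Proof.
move=> xa l0 l_cvg h_cvg.
have f_le t : 0 < t -> f (t *: h) <= f 0.
  move=> t0.
  have tl_cvg : t * lambda k @[k --> \oo] --> (0 : R).
    by rewrite -[X in _ --> X](mulr0 t); exact: cvgMl_tmp.
  have lhs : f (t *: (lambda k *: x k)) @[k --> \oo] --> f (t *: h).
    have th_cvg : t *: (lambda k *: x k) @[k --> \oo] --> t *: h.
      exact: cvgZl_tmp.
    exact: (cvg_comp _ _ th_cvg (@f_cont _)).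
  have rhs : t * lambda k * a + (1 - t * lambda k) * f 0 @[k --> \oo] --> f 0.
    rewrite -[X in _ --> X]add0r -[X in X + _](mul0r a).
    rewrite -[X in _ + X]mul1r -[X in _ + X * _]subr0.
    by apply: cvgD; apply: cvgMr_tmp => //; apply: cvgB => //; exact: cvg_cst.
  have tl_le1 : \forall k \near \oo, t * lambda k <= 1.
    exact: (cvgr_le _ tl_cvg).
  apply: (ler_cvg_to lhs rhs); near=> k.
  have tl0 : 0 < t * lambda k by rewrite mulr_gt0.
  have tl1 : t * lambda k <= 1 by near: k.
  have := @convex_functionT _ _ _ (t * lambda k) (x k) 0 f_convex.
  rewrite scaler0 addr0 -scalerA => /(_ _)/le_trans; apply; first by rewrite ltW.
  by rewrite lerD2r ler_pM2l.
apply: (cvge_le _ (@horizon_fun_cvg _ _ _ f_convex f_cont 0 h)).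
near=> t; have t0 : 0 < t by near: t; exact: nbhs_pinfty_gt.
by rewrite lee_fin add0r pmulr_lle0 ?invr_gt0// subr_le0 f_le.
Unshelve. all: by end_near. Qed.

End HorizonDirections.

(** * The parametric problem *)

Section ParametricProblem.
Context {R : realType} {n : nat} {Y : normedModType R}.
Variables (f : 'rV[R]_n -> R) (g : 'rV[R]_n -> Y) (K : set Y).
Hypotheses (f_cont : continuous f) (g_cont : continuous g) (K_closed : closed K)
  (f_convex : @convex_function R 'rV[R]_n setT f)
  (G_convex : graph_convex (GK g K)).
Hypothesis horizon_cond : forall h : 'rV[R]_n,
  (horizon_fun f h <= 0)%E -> horizon_map (GK g K) h 0 -> h = 0.

Local Notation nu := (value_fun f g K).
Local Notation X := (solution_set f g K).

(** The only place where the horizon condition is used: an unbounded family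
of feasible pairs would produce, after normalisation, a unit vector [h] that
the condition forces to vanish. *)
Lemma sublevel_bounded (a M : R) : exists B : R, forall x s,
  `|s| <= M -> feasible g K s x -> f x <= a -> `|x| <= B.
Proof.
apply: contrapT => /forallNP unb.
have ex (k : nat) : exists p : 'rV[R]_n * Y,
    [/\ `|p.2| <= M, feasible g K p.2 p.1, f p.1 <= a & k.+1%:R < `|p.1| ].
  have /existsNP[x /existsNP[s]] := unb k.+1%:R.
  move=> /not_implyP[sM /not_implyP[Kx /not_implyP[fa /negP]]].
  by rewrite -ltNge => xk; exists (x, s).
have [p pP] := choice ex.
have p0 k : 0 < `|(p k).1| by have [_ _ _] := pP k; apply: lt_trans.
pose lam k := `|(p k).1|^-1.
have lam0 k : 0 < lam k by rewrite invr_gt0.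
have lam_cvg : lam @ \oo --> (0 : R).
  apply: (squeeze_cvgr _ (cvg_cst 0) (@cvg_harmonic R)).
  near=> k; rewrite ltW//= /harmonic lef_pV2 ?posrE ?ltr0n//.
  by have [_ _ _ /ltW] := pP k.
pose S := [set x : 'rV[R]_n | `|x| = 1].
have cS : compact S.
  apply: bounded_closed_compact.
    by exists 1; split=> // e e1 x /= ->; exact: ltW.
  apply: (@closed_comp _ _ (fun x : 'rV[R]_n => `|x|) [set 1]) => [x _|].
    exact: norm_continuous.
  exact: closed_eq.
have Slam k : S (lam k *: (p k).1).
  by rewrite /S /= normrZ gtr0_norm ?lam0// mulVf// gt_eqF.
have [h [phi [Sh phi_cvg h_cvg]]] := compact_subsequence cS Slam.
have laphi_cvg : (lam \o phi) @ \oo --> (0 : R) by exact: cvg_comp phi_cvg lam_cvg.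
have h0 : h = 0.
  apply: horizon_cond.
    apply: (@horizon_fun_le0 _ _ f f_cont f_convex a (fun k => (p (phi k)).1)
      (lam \o phi)) => // k; last exact: lam0.
    by have [] := pP (phi k).
  rewrite /horizon_map /horizon_cone /=; right.
  exists (p \o phi), (lam \o phi); split => //=.
    by move=> k; rewrite graph_GK; have [] := pP (phi k).
  have s_cvg : lam (phi k) *: (p (phi k)).2 @[k --> \oo] --> (0 : Y).
    apply/norm_cvg0P.
    have lM : lam (phi k) * M @[k --> \oo] --> (0 : R).
      by rewrite -[X in _ --> X](mul0r M); exact: cvgMr_tmp.
    apply: (squeeze_cvgr _ (cvg_cst 0) lM); near=> k.
    rewrite normr_ge0 normrZ gtr0_norm// ler_pM2l//.
    by have [] := pP (phi k).
  exact: (cvg_pair h_cvg s_cvg).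
by move: Sh; rewrite /S /= h0 normr0 => /esym/eqP; rewrite oner_eq0.
Unshelve. all: by end_near. Qed.

Lemma feasible_cvg (s : nat -> Y) (x : nat -> 'rV[R]_n) s0 x0 :
  (forall k, feasible g K (s k) (x k)) -> s @ \oo --> s0 -> x @ \oo --> x0 ->
  feasible g K s0 x0.
Proof.
move=> Kx s_cvg x_cvg.
have gs_cvg : g (x k) + s k @[k --> \oo] --> g x0 + s0.
  by apply: cvgD => //; exact: (cvg_comp _ _ x_cvg (@g_cont _)).
by apply: (closed_cvg _ K_closed _ _ gs_cvg); exists 0%N => // k _; exact: Kx.
Qed.

Lemma feasible_convex (t : R) s1 s2 x1 x2 : 0 <= t <= 1 ->
  feasible g K s1 x1 -> feasible g K s2 x2 ->
  feasible g K (t *: s1 + (1 - t) *: s2) (t *: x1 + (1 - t) *: x2).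
Proof.
move=> t01 K1 K2; move: G_convex; rewrite /graph_convex graph_GK.
by move=> /convex_setP /(_ t (x1, s1) (x2, s2) t01 K1 K2).
Qed.

(** The sequence [x] itself need not converge; a bound on [x k] is available
only once [s k] is close to [s0], hence the shift by [N] in the proof. *)
Lemma sublevel_limit (a : R) (s : nat -> Y) (x : nat -> 'rV[R]_n) s0 :
  s @ \oo --> s0 -> (forall k, feasible g K (s k) (x k)) ->
  (forall k, f (x k) <= a) ->
  exists2 x0, feasible g K s0 x0 & f x0 <= a.
Proof.
move=> s_cvg Kx xa.
have [N _ sN] : \forall k \near \oo, `|s k| <= `|s0| + 1.
  by apply: (cvgr_le _ (cvg_norm s_cvg)); rewrite ltrDl.
have [B xB] := sublevel_bounded a (`|s0| + 1).
have cA : compact [set x : 'rV[R]_n | `|x| <= B].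
  apply: bounded_closed_compact.
    by exists B; split; [exact: num_real | move=> e Be y /= /le_trans; apply; exact: ltW].
  apply: (@closed_comp _ _ (fun x : 'rV[R]_n => `|x|) [set y | y <= B]) => [y _|].
    exact: norm_continuous.
  exact: closed_le.
have [|x0 [phi [_ phi_cvg x_cvg]]] :=
    @compact_subsequence _ _ _ (fun k => x (N + k)%N) cA.
  by move=> k; apply: (xB _ (s (N + k)%N)) => //; apply: sN; exact: leq_addr.
have sphi : s (N + phi k)%N @[k --> \oo] --> s0.
  have N_cvg : (fun k => (N + k)%N) @ \oo --> \oo.
    by apply: cvg_infty_ge => k; exact: leq_addl.
  exact: (cvg_comp _ _ (cvg_comp _ _ phi_cvg N_cvg) s_cvg).
exists x0; first by apply: feasible_cvg sphi x_cvg => k.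
by apply: (cvgr_to_le (cvg_comp _ _ x_cvg (@f_cont _))); near=> k; exact: xa.
Unshelve. all: by end_near. Qed.

Lemma sublevel_compact (a : R) s :
  compact [set x | feasible g K s x /\ f x <= a].
Proof.
apply: bounded_closed_compact.
  have [B xB] := sublevel_bounded a `|s|.
  exists B; split; first exact: num_real.
  by move=> e Be x [Kx xa]; apply: le_trans (ltW Be); exact: (xB x s).
apply: closedI.
  apply: (@closed_comp _ _ (fun x => g x + s) K) => // x _.
  exact: (cvgD (@g_cont x) (cvg_cst s)).
by apply: (@closed_comp _ _ f [set y | y <= a]) => [x _|]; [exact: f_cont | exact: closed_le].
Qed.

Lemma solution_exists s z : feasible g K s z -> exists x, X s x.
Proof.
move=> Kz; have cS := @sublevel_compact (f z) s.
have [||x /set_mem[Kx xz] xmin] := @EVT_min_rV _ _ f _ _ cS.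
- by exists z; split.
- exact: continuous_subspaceT.
exists x; split=> // y Ky.
have [yz|zy] := leP (f y) (f z); last exact: le_trans xz (ltW zy).
by apply: xmin; apply/mem_set.
Qed.

Lemma value_fun_solution s x : X s x -> nu s = (f x)%:E.
Proof.
move=> [Kx xmin]; apply/eqP; rewrite eq_le; apply/andP; split.
  by apply: ereal_inf_lbound; exists x.
by apply: le_ereal_inf_tmp => _ [z Kz <-]; rewrite lee_fin xmin.
Qed.

Lemma edom_feasible s : edom nu s -> feasible g K s !=set0.
Proof.
rewrite /edom /= => nus; apply/set0P/negP => /eqP K0.
by move: nus; rewrite /value_fun K0 image_set0 ereal_inf0 ltxx.
Qed.

Lemma domain_solution_set : domain X = edom nu.
Proof.
apply/seteqP; split=> s.
  by move=> [x Xx]; rewrite /edom /= (value_fun_solution Xx) ltry.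
by move=> /edom_feasible[z /solution_exists].
Qed.

(** Attainment of the infimum turns inequalities between extended reals into
existence of feasible points; lower semicontinuity and convexity of the value
function are proved through this equivalence. *)
Lemma value_fun_leP s (a : R) :
  (nu s <= a%:E)%E <-> exists2 x, feasible g K s x & f x <= a.
Proof.
split=> [nua|[x Kx xa]].
  have : edom nu s by rewrite /edom /= (le_lt_trans nua)// ltry.
  rewrite -domain_solution_set => -[x Xx].
  by exists x; [case: Xx | move: nua; rewrite (value_fun_solution Xx)].
by apply: (@le_trans _ _ (f x)%:E); [apply: ereal_inf_lbound; exists x|].
Qed.

Lemma value_fun_proper : K !=set0 -> proper_fun nu.
Proof.
move=> [k Kk]; split.
  exists (k - g 0); rewrite -domain_solution_set; apply: (@solution_exists _ 0).
  by rewrite /feasible /= addrC subrK.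
move=> s; have [|nus] := pselect (edom nu s).
  by rewrite -domain_solution_set => -[x /value_fun_solution ->]; rewrite ltNyr.
by apply: contra_notT nus; rewrite -leNgt leeNy_eq => /eqP; rewrite /edom /= => ->.
Qed.

Lemma value_fun_lsc : lower_semicontinuous nu.
Proof.
move=> s a asl; apply: contrapT => /forall2NP noV.
have ex (k : nat) : exists y, `|s - y| < k.+1%:R^-1 /\ (nu y <= a%:E)%E.
  have [|/existsNP[y /not_implyP[/= sy /negP]]] := noV (ball s k.+1%:R^-1).
    by case; apply: nbhsx_ballx; rewrite invr_gt0 ltr0n.
  by rewrite -leNgt => ya; exists y; rewrite -ball_normE in sy.
have [y yP] := choice ex.
have y_cvg : y @ \oo --> s.
  apply/cvgrPdist_lt => e e0; near=> k.
  apply: lt_trans (yP k).1 _.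
  by near: k; exact: near_infty_natSinv_lt (PosNum e0).
have exx k : exists x, feasible g K (y k) x /\ f x <= a.
  by have /value_fun_leP[x] := (yP k).2; exists x.
have [x xP] := choice exx.
have [x0 Kx0 x0a] : exists2 x0, feasible g K s x0 & f x0 <= a.
  by apply: (sublevel_limit (a := a) y_cvg (x := x)) => k; case: (xP k).
have /value_fun_leP : exists2 x0, feasible g K s x0 & f x0 <= a by exists x0.
by rewrite leNgt asl.
Unshelve. all: by end_near. Qed.

Lemma value_fun_convex : econvex nu.
Proof.
apply/econvexP => t a b s1 s2 t01 /value_fun_leP[x1 K1 x1a] /value_fun_leP[x2 K2 x2b].
apply/value_fun_leP; exists (t *: x1 + (1 - t) *: x2); first exact: feasible_convex.
apply: (le_trans (convex_functionT _ _ f_convex t01)).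
have /andP[t0 t1] := t01.
by rewrite lerD// ler_wpM2l// subr_ge0.
Qed.

(** In this form the solution set inherits compactness and convexity from the
sublevel sets of [f] on the feasible set. *)
Lemma solution_set_sublevel s x : X s x ->
  X s = [set y | feasible g K s y /\ f y <= f x].
Proof.
move=> [Kx xmin]; apply/seteqP; split=> y [Ky ymin]; split=> //; first exact: ymin.
by move=> z Kz; apply: le_trans ymin (xmin _ Kz).
Qed.

Lemma solution_set_compact s : compact (X s).
Proof.
have [->|/set0P[x Xx]] := eqVneq (X s) set0; first exact: compact0.
by rewrite (solution_set_sublevel Xx); exact: sublevel_compact.
Qed.

Lemma solution_set_convex s : @convex_set R 'rV[R]_n (X s).
Proof.
apply/convex_setP => t x y t01 Xx Xy.
have yx : f y <= f x by case: Xx Xy => [Kx _] [_]; exact.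
have [Kx _] := Xx; have [Ky _] := Xy.
rewrite (solution_set_sublevel Xx); split.
  by have := feasible_convex t01 Kx Ky; rewrite -scalerDl addrC subrK scale1r.
apply: (le_trans (convex_functionT _ _ f_convex t01)).
have /andP[t0 t1] := t01.
have : (1 - t) * f y <= (1 - t) * f x by rewrite ler_wpM2l// subr_ge0.
lra.
Qed.

(** The common core of both outer semicontinuity statements: they differ only
in how they ensure that the values at [u k] are asymptotically at most the
value at [a]. *)
Lemma solution_set_limit (u : nat -> Y) a (v : nat -> 'rV[R]_n) b :
  (forall c e : R, (nu a <= c%:E)%E -> 0 < e ->
    \forall k \near \oo, (nu (u k) <= (c + e)%:E)%E) ->
  u @ \oo --> a -> (forall k, X (u k) (v k)) -> v @ \oo --> b -> X a b.
Proof.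
move=> usc u_cvg Xv v_cvg; split.
  by apply: feasible_cvg u_cvg v_cvg => k; case: (Xv k).
move=> z Kz; apply/ler_addgt0Pr => e e0.
apply: (cvgr_to_le (cvg_comp _ _ v_cvg (@f_cont _))).
have za : (nu a <= (f z)%:E)%E by apply/value_fun_leP; exists z.
have := usc _ _ za e0; apply: filterS => k.
by rewrite (value_fun_solution (Xv k)) lee_fin.
Qed.

Lemma solution_set_osc_attentive : osc_attentive nu X.
Proof.
move=> u a v b u_cvg nu_cvg Xv v_cvg.
apply: solution_set_limit u_cvg Xv v_cvg => c e ac e0.
have : (nu a < (c + e)%:E)%E by apply: le_lt_trans ac _; rewrite lte_fin ltrDl.
move=> /open_ereal_lt' alt.
have : \forall k \near \oo, (nu (u k) < (c + e)%:E)%E := nu_cvg _ alt.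
by apply: filterS => k; exact: ltW.
Qed.

(** Near [a] the solutions have values at most [M], so they all lie in one
bounded sublevel set. *)
Lemma solution_set_locally_bounded (U : set Y) :
  (forall a, U a -> exists M : R, \forall s \near a, (nu s <= M%:E)%E) ->
  locally_bounded_rel X U.
Proof.
move=> Ubd a /Ubd[M aM]; have [B xB] := sublevel_bounded M (`|a| + 1).
have a1 : \forall s \near a, `|s| <= `|a| + 1.
  apply: filterS (near_dist_lt a (@ltr01 R)) => s /ltW as1.
  by rewrite -lerBlDl (le_trans (lerB_dist _ _))// distrC.
exists [set s | (nu s <= M%:E)%E /\ `|s| <= `|a| + 1]; first exact: filterI.
exists B; split; first exact: num_real.
move=> e Be x [s [[sM sa] _] Xx]; apply: le_trans (ltW Be).
apply: xB sa _ _; first by case: Xx.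
by rewrite -lee_fin -(value_fun_solution Xx).
Qed.

End ParametricProblem.

(** * The value function and the solution mapping *)

Theorem proposition2p3 (R : realType) (n : nat)
    (Y : completeNormedModType R) (dotp : {dot Y for @idfun R})
    (Y_hilbert : norm_of_dot dotp) (Y_findim : finite_dimensional Y)
    (K : set Y) (K_neq0 : K !=set0) (K_closed : closed K)
    (K_convex : @convex_set R Y K)
    (f : 'rV[R]_n -> R) (f_cont : continuous f)
    (f_convex : @convex_function R 'rV[R]_n setT f)
    (g : 'rV[R]_n -> Y) (g_cont : continuous g)
    (G_convex : graph_convex (GK g K))
    (horizon_cond : forall h : 'rV[R]_n,
      (horizon_fun f h <= 0)%E -> horizon_map (GK g K) h 0 -> h = 0) :
  let nu := value_fun f g K in
  let X := solution_set f g K in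
  [/\ (* (a) *)
      [/\ proper_fun nu, lower_semicontinuous nu, econvex nu,
          (forall s, edom nu s ->
            [/\ X s !=set0, compact (X s) & @convex_set R 'rV[R]_n (X s)]) &
          (forall s, ~ edom nu s -> X s = set0)],
      (* (b) *)
      [/\ forall s, compact (X s), domain X = edom nu & osc_attentive nu X] &
      (* (c) *)
      [/\ interior (domain X) = interior (edom nu),
          locally_bounded_rel X (interior (domain X)) &
          osc_rel X (interior (domain X))]].
Proof.
move=> nu X.
have domX : domain X = edom nu by exact: domain_solution_set.
have nu_lsc : lower_semicontinuous nu by exact: value_fun_lsc.
have nu_cvx : econvex nu by exact: value_fun_convex.
have X_compact s : compact (X s) by exact: solution_set_compact.
split; first split => //.
- exact: value_fun_proper.
- move=> s; rewrite -domX => Xs; split => //; exact: solution_set_convex.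
- by move=> s; rewrite -domX => /set0P/negP/negPn/eqP.
- by split => //; exact: solution_set_osc_attentive.
rewrite domX; split => //.
- apply: solution_set_locally_bounded => // a.
  exact: interior_edom_locally_bounded.
- move=> u a v b _ a_int u_cvg Xv v_cvg.
  apply: solution_set_limit (u_cvg) Xv v_cvg => // c e ac e0.
  exact: u_cvg (econvex_usc nu_lsc nu_cvx a_int ac e0).
Qed.
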